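(* Let $\mathcal{E}$ be a category with pull-backs, let $A$, $E$, $X$ be objects of $\mathcal{E}$, and let $U \subseteq_X A$ be a generalized subobject of $A$ at stage $X$. Suppose given a law $\sigma$ which to each arrow $\alpha : Y \to X$ and each $a \in_Y \alpha^*(U)$ associates a generalized element $\sigma(a,\alpha) \in_Y E$, in a way which is stable under change of stage, i.e. $\sigma(a,\alpha) \circ \beta = \sigma(a \circ \beta, \alpha \circ \beta)$ for any $\beta : Z \to Y$. Then there is a unique generalized partial map $s : A \dashrightarrow_U E$ at stage $X$ with support $U$ such that for every $\alpha : Y \to X$ and every $a \in_Y \alpha^*(U)$ we have $\alpha^*(s)(a) = \sigma(a,\alpha)$.
   Context: $\mathcal{E}$ is a category with pull-backs (no terminal object or binary products are assumed). Generalized elements: $a \in_Y A$ means that $a : Y \to A$ is an arrow of $\mathcal{E}$. Generalized subobjects: a generalized subobject $U$ of $A$ at stage $X$, written $U \subseteq_X A$, is an equivalence class of jointly monic spans $A \xleftarrow{c} M \xrightarrow{d} X$, where $(c,d)$ and $(c',d')$ (with middle objects $M$, $M'$) are equivalent if there is an isomorphism $\mu : M \to M'$ with $c' \circ \mu = c$ and $d' \circ \mu = d$. Change of stage: for $U \subseteq_X A$ represented by $(c,d)$ and $\alpha : Y \to X$, form a pull-back of $d$ along $\alpha$, with projections $m : P \to M$ and $d' : P \to Y$; then $\alpha^*(U) \subseteq_Y A$ is the generalized subobject represented by the jointly monic span $(c \circ m, d')$. It does not depend on the choices. Membership: for $V \subseteq_Y A$ represented by $A \xleftarrow{c} N \xrightarrow{d}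 Y$ and $a \in_Y A$, $a \in_Y V$ means that there is a (necessarily unique) witness $a_0 : Y \to N$ with $c \circ a_0 = a$ and $d \circ a_0 = \mathrm{id}_Y$. For $\alpha : Y\to X$, $U\subseteq_X A$ represented by $A \xleftarrow{c} M \xrightarrow{d} X$, and $a \in_Y A$, the condition $a \in_Y \alpha^*(U)$ is equivalent to the existence of $a_0 : Y \to M$ with $c \circ a_0 = a$ and $d \circ a_0 = \alpha$. If $a \in_Y \alpha^*(U)$ and $\beta : Z \to Y$, then $a \circ \beta \in_Z (\alpha\circ\beta)^*(U)$. Generalized partial maps: a generalized partial map $s : A \dashrightarrow_U E$ at stage $X$ with support $U \subseteq_X A$ is an equivalence class of triples $(t,c,d)$ with $(c,d)$ a jointly monic span $A \xleftarrow{c} M \xrightarrow{d} X$ representing $U$ and $t : M \to E$ an arrow; $(t,c,d)$ and $(t',c',d')$ are equivalent if there is an isomorphism $\mu : M \to M'$ with $c'\circ\mu = c$, $d' \circ \mu = d$, $t' \circ \mu = t$. For $\alpha : Y \to X$, $\alpha^*(s) : A \dashrightarrow_{\alpha^*(U)} E$ is the generalized partial map at stage $Y$ represented by $(t \circ m, c \circ m, d')$, with $m, d'$ the projections of a pull-back of $d$ along $\alpha$. Value: if $s : A \dashrightarrow_V E$ is at stage $Y$, represented by $(t,c,d)$, and $a \in_Y V$ has witness $a_0$, then $s(a) := t \circ a_0 \in_Y E$. *)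

(* Defs.v *)
From Stdlib Require Import ClassicalEpsilon.

Set Implicit Arguments.
Unset Strict Implicit.

Record category := Category {
  Ob :> Type;
  Hom : Ob -> Ob -> Type;
  idm : forall A, Hom A A;
  comp : forall {A B C}, Hom B C -> Hom A B -> Hom A C;
  comp_assoc : forall A B C D (h : Hom C D) (g : Hom B C) (f : Hom A B),
    comp h (comp g f) = comp (comp h g) f;
  comp_id_l : forall A B (f : Hom A B), comp (idm B) f = f;
  comp_id_r : forall A B (f : Hom A B), comp f (idm A) = f
}.
Arguments Hom {_} _ _.
Arguments idm {_} _.
Arguments comp {_ _ _ _} _ _.

Notation "g ∘ f" := (comp g f) (at level 40, left associativity).

Definition is_iso {C : category} {A B : C} (f : Hom A B) : Prop :=
  exists g : Hom B A, g ∘ f = idm A /\ f ∘ g = idm B.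

Definition is_pullback {C : category} {A B D : C} (f : Hom A D) (g : Hom B D)
    {P : C} (p1 : Hom P A) (p2 : Hom P B) : Prop :=
  f ∘ p1 = g ∘ p2 /\
  forall (Z : C) (u : Hom Z A) (v : Hom Z B), f ∘ u = g ∘ v ->
    exists! w : Hom Z P, p1 ∘ w = u /\ p2 ∘ w = v.

Record pb_category := PbCategory {
  pb_cat :> category;
  has_pullback : forall (A B D : pb_cat) (f : Hom A D) (g : Hom B D),
    exists (P : pb_cat) (p1 : Hom P A) (p2 : Hom P B), is_pullback f g p1 p2
}.

Definition jointly_monic {C : category} {A X M : C}
    (c : Hom M A) (d : Hom M X) : Prop :=
  forall (Z : C) (u v : Hom Z M), c ∘ u = c ∘ v -> d ∘ u = d ∘ v -> u = v.

Record mono_span {C : category} (A X : C) := MonoSpan {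
  apex : C;
  lleg : Hom apex A;
  rleg : Hom apex X;
  legs_jm : jointly_monic lleg rleg
}.

Definition span_equiv {C : category} {A X : C} (p q : mono_span A X) : Prop :=
  exists mu : Hom (apex p) (apex q),
    is_iso mu /\ lleg q ∘ mu = lleg p /\ rleg q ∘ mu = rleg p.

Definition is_class {T : Type} (R : T -> T -> Prop) (K : T -> Prop) : Prop :=
  exists x, forall y, K y <-> R x y.

(* [gsub A X] is the type of U ⊆_X A: a generalized subobject is literally an
   equivalence class of spans, so [U p] means that the span p represents U. *)
Record gsub {C : category} (A X : C) := Gsub {
  gsub_rep :> mono_span A X -> Prop;
  gsub_class : is_class span_equiv gsub_rep
}.

Record triple {C : category} (A E X : C) := Triple {
  tspan :> mono_span A X;
  tmap : Hom (apex tspan) E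
}.

Definition triple_equiv {C : category} {A E X : C} (p q : triple A E X) : Prop :=
  exists mu : Hom (apex p) (apex q),
    is_iso mu /\ lleg q ∘ mu = lleg p /\ rleg q ∘ mu = rleg p /\
    tmap q ∘ mu = tmap p.

(* [gpmap U E] is the type of s : A ⇢_U E, at the stage X of U; again [s q]
   means that the triple q represents s. *)
Record gpmap {C : category} {A X : C} (U : gsub A X) (E : C) := Gpmap {
  gpmap_rep :> triple A E X -> Prop;
  gpmap_class : is_class triple_equiv gpmap_rep;
  gpmap_supp : forall q, gpmap_rep q -> U (tspan q)
}.

Lemma iso_id {C : category} (A : C) : is_iso (idm A).
Proof. exists (idm A); split; apply comp_id_l. Qed.

Lemma iso_comp {C : category} {A B D : C} (g : Hom B D) (f : Hom A B) :
  is_iso g -> is_iso f -> is_iso (g ∘ f).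
Proof.
intros [g' [g1 g2]] [f' [f1 f2]]; exists (f' ∘ g'); split.
- now rewrite comp_assoc, <- (comp_assoc f'), g1, comp_id_r.
- now rewrite comp_assoc, <- (comp_assoc g), f2, comp_id_r.
Qed.

Lemma triple_equiv_refl {C : category} {A E X : C} (p : triple A E X) :
  triple_equiv p p.
Proof. exists (idm _); split; [apply iso_id|]; now rewrite !comp_id_r. Qed.

Lemma triple_equiv_sym {C : category} {A E X : C} (p q : triple A E X) :
  triple_equiv p q -> triple_equiv q p.
Proof.
intros [mu [[nu [h1 h2]] [e1 [e2 e3]]]]; exists nu; split; [now exists mu|].
now rewrite <- e1, <- e2, <- e3, <- !comp_assoc, h2, !comp_id_r.
Qed.

Lemma triple_equiv_trans {C : category} {A E X : C} (p q r : triple A E X) :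
  triple_equiv p q -> triple_equiv q r -> triple_equiv p r.
Proof.
intros [mu [i [e1 [e2 e3]]]] [nu [j [f1 [f2 f3]]]]; exists (nu ∘ mu).
split; [now apply iso_comp|]; now rewrite !comp_assoc, f1, f2, f3.
Qed.

Lemma span_equiv_refl {C : category} {A X : C} (p : mono_span A X) :
  span_equiv p p.
Proof. exists (idm _); split; [apply iso_id|]; now rewrite !comp_id_r. Qed.

Lemma span_equiv_sym {C : category} {A X : C} (p q : mono_span A X) :
  span_equiv p q -> span_equiv q p.
Proof.
intros [mu [[nu [h1 h2]] [e1 e2]]]; exists nu; split; [now exists mu|].
now rewrite <- e1, <- e2, <- !comp_assoc, h2, !comp_id_r.
Qed.

Lemma span_equiv_trans {C : category} {A X : C} (p q r : mono_span A X) :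
  span_equiv p q -> span_equiv q r -> span_equiv p r.
Proof.
intros [mu [i [e1 e2]]] [nu [j [f1 f2]]]; exists (nu ∘ mu).
split; [now apply iso_comp|]; now rewrite !comp_assoc, f1, f2.
Qed.

Lemma gsub_equiv {C : category} {A X : C} (U : gsub A X) (p q : mono_span A X) :
  U p -> U q -> span_equiv p q.
Proof.
destruct (gsub_class U) as [r Hr]; intros Hp Hq; apply Hr in Hp; apply Hr in Hq.
exact (span_equiv_trans (span_equiv_sym Hp) Hq).
Qed.

Lemma gsub_closed {C : category} {A X : C} (U : gsub A X) (p q : mono_span A X) :
  U p -> span_equiv p q -> U q.
Proof.
destruct (gsub_class U) as [r Hr]; intros Hp Hpq; apply Hr in Hp; apply Hr.
exact (span_equiv_trans Hp Hpq).
Qed.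

Lemma gpmap_equiv {C : category} {A X E : C} {U : gsub A X} (s : gpmap U E)
    (p q : triple A E X) :
  s p -> s q -> triple_equiv p q.
Proof.
destruct (gpmap_class s) as [r Hr]; intros Hp Hq; apply Hr in Hp; apply Hr in Hq.
exact (triple_equiv_trans (triple_equiv_sym Hp) Hq).
Qed.

Lemma pullback_jm {C : category} {A X Y : C} (p : mono_span A X)
    (al : Hom Y X) (P : C) (m : Hom P (apex p)) (d' : Hom P Y) :
  is_pullback (rleg p) al m d' -> jointly_monic (lleg p ∘ m) d'.
Proof.
intros [e up] Z u v hc hd.
assert (hm : m ∘ u = m ∘ v).
{ apply (legs_jm (m := p)).
  - now rewrite !comp_assoc.
  - now rewrite !comp_assoc, e, <- !comp_assoc, hd. }
destruct (up Z (m ∘ v) (d' ∘ v)) as [w [_ uw]].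
{ now rewrite !comp_assoc, e. }
now rewrite <- (uw u), <- (uw v).
Qed.

Definition pull_span {C : category} {A X Y : C} (p : mono_span A X)
    (al : Hom Y X) (P : C) (m : Hom P (apex p)) (d' : Hom P Y)
    (pb : is_pullback (rleg p) al m d') : mono_span A Y :=
  MonoSpan (@pullback_jm C A X Y p al P m d' pb).

Definition pull_triple {C : category} {A E X Y : C} (q : triple A E X)
    (al : Hom Y X) (P : C) (m : Hom P (apex q)) (d' : Hom P Y)
    (pb : is_pullback (rleg q) al m d') : triple A E Y :=
  Triple (tspan := pull_span pb) (tmap q ∘ m).

Lemma pullback_iso {C : category} {M M' X Y : C} (d : Hom M X) (d1 : Hom M' X)
    (al : Hom Y X) (nu : Hom M M')
    (P P' : C) (m : Hom P M) (e : Hom P Y) (m' : Hom P' M') (e' : Hom P' Y) :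
  is_iso nu -> d1 ∘ nu = d ->
  is_pullback d al m e -> is_pullback d1 al m' e' ->
  exists mu : Hom P P', is_iso mu /\ m' ∘ mu = nu ∘ m /\ e' ∘ mu = e.
Proof.
intros [nu' [n1 n2]] hd [sq up] [sq' up'].
destruct (up' P (nu ∘ m) e) as [mu [[h1 h2] _]].
{ now rewrite comp_assoc, hd. }
destruct (up P' (nu' ∘ m') e') as [mu' [[k1 k2] _]].
{ now rewrite <- hd, <- comp_assoc, (comp_assoc nu), n2, comp_id_l. }
exists mu; split; [exists mu'; split|now split].
- destruct (up P m e sq) as [w [_ uw]].
  rewrite <- (uw (mu' ∘ mu)), <- (uw (idm P)); trivial.
  + now rewrite !comp_id_r.
  + rewrite !comp_assoc, k1, k2, <- comp_assoc, h1, comp_assoc, n1, comp_id_l.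
    now split.
- destruct (up' P' m' e' sq') as [w [_ uw]].
  rewrite <- (uw (mu ∘ mu')), <- (uw (idm P')); trivial.
  + now rewrite !comp_id_r.
  + rewrite !comp_assoc, h1, h2, <- comp_assoc, k1, comp_assoc, n2, comp_id_l.
    now split.
Qed.

Lemma pull_span_equiv {C : category} {A X Y : C} (p q : mono_span A X)
    (al : Hom Y X) (P : C) (m : Hom P (apex p)) (d' : Hom P Y)
    (pb : is_pullback (rleg p) al m d')
    (Q : C) (n : Hom Q (apex q)) (e' : Hom Q Y)
    (qb : is_pullback (rleg q) al n e') :
  span_equiv p q -> span_equiv (pull_span pb) (pull_span qb).
Proof.
intros [nu [i [h1 h2]]].
destruct (pullback_iso i h2 pb qb) as [mu [j [k1 k2]]].
exists mu; split; [exact j|]; simpl.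
now rewrite <- comp_assoc, k1, comp_assoc, h1.
Qed.

Lemma pull_triple_equiv {C : category} {A E X Y : C} (p q : triple A E X)
    (al : Hom Y X) (P : C) (m : Hom P (apex p)) (d' : Hom P Y)
    (pb : is_pullback (rleg p) al m d')
    (Q : C) (n : Hom Q (apex q)) (e' : Hom Q Y)
    (qb : is_pullback (rleg q) al n e') :
  triple_equiv p q -> triple_equiv (pull_triple pb) (pull_triple qb).
Proof.
intros [nu [i [h1 [h2 h3]]]].
destruct (pullback_iso i h2 pb qb) as [mu [j [k1 k2]]].
exists mu; split; [exact j|]; simpl.
now rewrite <- !comp_assoc, k1, !comp_assoc, h1, h3.
Qed.

(* The classes of all pull-backs of all representatives; [stage_sub_class] and
   [stage_map_class] show that they form a single equivalence class, i.e. that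
   α^*(U) and α^*(s) do not depend on the choices. *)
Definition stage_sub_rep {C : category} {A X Y : C} (al : Hom Y X)
    (U : gsub A X) (r : mono_span A Y) : Prop :=
  exists (p : mono_span A X) (P : C) (m : Hom P (apex p)) (d' : Hom P Y)
         (pb : is_pullback (rleg p) al m d'),
    U p /\ span_equiv (pull_span pb) r.

Lemma stage_sub_class {C : pb_category} {A X Y : C} (al : Hom Y X)
    (U : gsub A X) : is_class span_equiv (stage_sub_rep al U).
Proof.
destruct (gsub_class U) as [p Hp].
destruct (has_pullback (rleg p) al) as [P [m [d' pb]]].
exists (pull_span pb); intros r; split.
- intros [q [Q [n [e' [qb [Hq Hr]]]]]].
  apply (fun h => span_equiv_trans h Hr), pull_span_equiv; now apply Hp.
- intros Hr; exists p, P, m, d', pb; split; trivial.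
  apply Hp, span_equiv_refl.
Qed.

Definition stage_sub {C : pb_category} {A X Y : C} (al : Hom Y X)
    (U : gsub A X) : gsub A Y := Gsub (stage_sub_class al U).

Definition stage_map_rep {C : category} {A X Y E : C} (al : Hom Y X)
    {U : gsub A X} (s : gpmap U E) (r : triple A E Y) : Prop :=
  exists (q : triple A E X) (P : C) (m : Hom P (apex q)) (d' : Hom P Y)
         (pb : is_pullback (rleg q) al m d'),
    s q /\ triple_equiv (pull_triple pb) r.

Lemma stage_map_class {C : pb_category} {A X Y E : C} (al : Hom Y X)
    {U : gsub A X} (s : gpmap U E) : is_class triple_equiv (stage_map_rep al s).
Proof.
destruct (gpmap_class s) as [p Hp].
destruct (has_pullback (rleg p) al) as [P [m [d' pb]]].
exists (pull_triple pb); intros r; split.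
- intros [q [Q [n [e' [qb [Hq Hr]]]]]].
  apply (fun h => triple_equiv_trans h Hr), pull_triple_equiv; now apply Hp.
- intros Hr; exists p, P, m, d', pb; split; trivial.
  apply Hp, triple_equiv_refl.
Qed.

Lemma stage_map_supp {C : pb_category} {A X Y E : C} (al : Hom Y X)
    {U : gsub A X} (s : gpmap U E) (r : triple A E Y) :
  stage_map_rep al s r -> stage_sub al U (tspan r).
Proof.
intros [q [P [m [d' [pb [Hq [mu [i [h1 [h2 _]]]]]]]]]].
exists q, P, m, d', pb; split; [now apply (gpmap_supp Hq)|].
now exists mu.
Qed.

Definition stage_map {C : pb_category} {A X Y E : C} (al : Hom Y X)
    {U : gsub A X} (s : gpmap U E) : gpmap (stage_sub al U) E :=
  Gpmap (stage_map_class al s) (@stage_map_supp C A X Y E al U s).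

Definition is_witness {C : category} {A Y : C} (a : Hom Y A)
    (p : mono_span A Y) (a0 : Hom Y (apex p)) : Prop :=
  lleg p ∘ a0 = a /\ rleg p ∘ a0 = idm Y.

(* a ∈_Y V *)
Definition mem {C : category} {A Y : C} (a : Hom Y A) (V : gsub A Y) : Prop :=
  exists (p : mono_span A Y) (a0 : Hom Y (apex p)), V p /\ is_witness a a0.

Lemma mem_rep {C : category} {A Y : C} (a : Hom Y A) (V : gsub A Y)
    (p : mono_span A Y) :
  V p -> mem a V -> exists! a0 : Hom Y (apex p), is_witness a a0.
Proof.
intros Hp [q [a0 [Hq [h1 h2]]]].
destruct (gsub_equiv Hq Hp) as [mu [i [e1 e2]]].
exists (mu ∘ a0); split.
- now split; rewrite comp_assoc, ?e1, ?e2.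
- intros b [k1 k2]; apply (legs_jm (m := p)); rewrite comp_assoc.
  + now rewrite e1, k1.
  + now rewrite e2, k2.
Qed.

Lemma mem_stage {C : pb_category} {A X Y : C} (U : gsub A X) (al : Hom Y X)
    (a : Hom Y A) (p : mono_span A X) : U p ->
  mem a (stage_sub al U) <->
  exists a0 : Hom Y (apex p), lleg p ∘ a0 = a /\ rleg p ∘ a0 = al.
Proof.
intros Hp; destruct (has_pullback (rleg p) al) as [P [m [d' pb]]].
assert (HP : stage_sub al U (pull_span pb)).
{ exists p, P, m, d', pb; split; [exact Hp|apply span_equiv_refl]. }
split.
- intros Ha; destruct (mem_rep HP Ha) as [b [[h1 h2] _]]; simpl in *.
  exists (m ∘ b); split; [now rewrite comp_assoc|].
  now rewrite comp_assoc, (proj1 pb), <- comp_assoc, h2, comp_id_r.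
- intros [a0 [h1 h2]].
  destruct (proj2 pb Y a0 (idm Y)) as [w [[k1 k2] _]].
  { now rewrite comp_id_r. }
  exists (pull_span pb), w; split; [exact HP|]; split; simpl; trivial.
  now rewrite <- comp_assoc, k1.
Qed.

Lemma mem_comp {C : pb_category} {A X Y Z : C} (U : gsub A X) (al : Hom Y X)
    (a : Hom Y A) (be : Hom Z Y) :
  mem a (stage_sub al U) -> mem (a ∘ be) (stage_sub (al ∘ be) U).
Proof.
destruct (gsub_class U) as [p Hp].
assert (Up : U p) by apply Hp, span_equiv_refl.
intros Ha; apply (mem_stage al a Up) in Ha; destruct Ha as [a0 [h1 h2]].
apply (mem_stage _ _ Up); exists (a0 ∘ be).
now rewrite !comp_assoc, h1, h2.
Qed.

Lemma value_exists {C : category} {A Y E : C} {V : gsub A Y} (s : gpmap V E)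
    (a : Hom Y A) : mem a V ->
  exists y : Hom Y E, exists (q : triple A E Y) (a0 : Hom Y (apex q)),
    s q /\ is_witness a a0 /\ y = tmap q ∘ a0.
Proof.
intros Ha; destruct (gpmap_class s) as [q Hq].
assert (sq : s q) by apply Hq, triple_equiv_refl.
destruct (mem_rep (gpmap_supp sq) Ha) as [a0 [h _]].
now exists (tmap q ∘ a0), q, a0.
Qed.

(* s(a).  The description operator only extracts the arrow t ∘ a0, which is
   determined by s and a: see [valueE]. *)
Definition value {C : category} {A Y E : C} {V : gsub A Y} (s : gpmap V E)
    (a : Hom Y A) (Ha : mem a V) : Hom Y E :=
  proj1_sig (constructive_indefinite_description _ (value_exists s Ha)).

Lemma valueE {C : category} {A Y E : C} {V : gsub A Y} (s : gpmap V E)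
    (a : Hom Y A) (Ha : mem a V) (q : triple A E Y) (a0 : Hom Y (apex q)) :
  s q -> is_witness a a0 -> value s Ha = tmap q ∘ a0.
Proof.
intros sq [h1 h2]; unfold value.
destruct (constructive_indefinite_description _ _)
  as [y [r [b [sr [[k1 k2] e]]]]]; simpl; subst y.
destruct (gpmap_equiv sr sq) as [mu [i [e1 [e2 e3]]]].
rewrite <- e3, <- comp_assoc; f_equal.
apply (legs_jm (m := q)); rewrite comp_assoc.
- now rewrite e1, k1.
- now rewrite e2, k2.
Qed.

(* The proof argument carries no data: proofs of [mem] are irrelevant in the
   presence of propositional extensionality, so σ depends only on (a, α). *)
Definition law {C : pb_category} {A X : C} (U : gsub A X) (E : C) : Type :=
  forall (Y : C) (al : Hom Y X) (a : Hom Y A), mem a (stage_sub al U) -> Hom Y E.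

Definition stable_law {C : pb_category} {A X E : C} {U : gsub A X}
    (sigma : law U E) : Prop :=
  forall (Y Z : C) (al : Hom Y X) (a : Hom Y A) (Ha : mem a (stage_sub al U))
         (be : Hom Z Y),
    sigma Y al a Ha ∘ be = sigma Z (al ∘ be) (a ∘ be) (mem_comp be Ha).

(* Main.v *)
Require Import Defs.
From Stdlib Require Import Classical_Prop FunctionalExtensionality PropExtensionality.

(** The argument is that of the Yoneda lemma.  Fix a span [(c, d)] with middle
    object [M] representing [U].  By [mem_stage], the elements of [α^*(U)] at
    stage [Y] are the arrows [a0 : Y -> M] with [d ∘ a0 = α], the element being
    [a = c ∘ a0].  So every element of [U], at whatever stage, is obtained by
    change of stage from the generic one, namely [c] itself, which belongs to
    [d^*(U)] with [a0 = id].  A partial map represented by [(t, c, d)] takes the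
    value [t ∘ a0] at [a] ([value_stage]), in particular the value [t] at the
    generic element.

    Hence the condition at the generic element forces [t = σ(c, d)].  As every
    partial map with support [U] has a representative over the chosen span
    ([gpmap_rep_over]), this gives uniqueness.  Conversely, with this [t], the
    stability of [σ] gives [t ∘ a0 = σ(c ∘ a0, d ∘ a0) = σ(a, α)], which is
    existence. *)

(** Both sides are equivalence classes of triples, and classes that meet
    coincide. *)
Lemma gpmap_eq {C : category} {A X E : C} {U : gsub A X} {s s' : gpmap U E}
    {q : triple A E X} : s q -> s' q -> s = s'.
Proof.
intros sq sq'.
assert (e : gpmap_rep s = gpmap_rep s').
{ destruct (gpmap_class s) as [r Hr], (gpmap_class s') as [r' Hr'].
  apply functional_extensionality; intros x; apply propositional_extensionality.
  apply Hr in sq; apply Hr' in sq'; rewrite Hr, Hr'; split; intros h.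
  - exact (triple_equiv_trans sq' (triple_equiv_trans (triple_equiv_sym sq) h)).
  - exact (triple_equiv_trans sq (triple_equiv_trans (triple_equiv_sym sq') h)). }
destruct s as [r k h], s' as [r' k' h']; simpl in e; subst r'.
now rewrite (proof_irrelevance _ k k'), (proof_irrelevance _ h h').
Qed.

(** Any representative of [s] can be transported along the isomorphism between
    its span and [p]. *)
Lemma gpmap_rep_over {C : category} {A X E : C} {U : gsub A X} (s : gpmap U E)
    (p : mono_span A X) : U p ->
  exists t : Hom (apex p) E, s (Triple (tspan := p) t).
Proof.
intros Up; destruct (gpmap_class s) as [q Hq].
assert (sq : s q) by apply Hq, triple_equiv_refl.
destruct (gsub_equiv Up (gpmap_supp sq)) as [mu [i [e1 e2]]].
exists (tmap q ∘ mu); apply Hq, triple_equiv_sym; now exists mu.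
Qed.

Lemma gpmap_of_map {C : category} {A X E : C} {U : gsub A X} {p : mono_span A X}
    (Up : U p) (t : Hom (apex p) E) :
  exists s : gpmap U E, s (Triple (tspan := p) t).
Proof.
pose (q := Triple (tspan := p) t).
assert (cl : is_class triple_equiv (triple_equiv q)) by now exists q.
assert (supp : forall r, triple_equiv q r -> U (tspan r)).
{ intros r [mu [i [e1 [e2 _]]]]; apply (gsub_closed Up); now exists mu. }
exists (Gpmap cl supp); apply triple_equiv_refl.
Qed.

(** The values of [α^*(s)] can be computed on a representative of [s] itself:
    the universal property of the pull-back turns [a0], lying over [α], into a
    witness at stage [Y], whose projection is again [a0]. *)
Lemma value_stage {C : pb_category} {A X Y E : C} {U : gsub A X} (s : gpmap U E)
    {al : Hom Y X} {a : Hom Y A} (Ha : mem a (stage_sub al U))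
    {q : triple A E X} {a0 : Hom Y (apex q)} :
  s q -> lleg q ∘ a0 = a -> rleg q ∘ a0 = al ->
  value (stage_map al s) Ha = tmap q ∘ a0.
Proof.
intros sq h1 h2.
destruct (has_pullback (rleg q) al) as [P [m [d' pb]]].
destruct (proj2 pb Y a0 (idm Y)) as [w [[k1 k2] _]].
{ now rewrite comp_id_r. }
rewrite (@valueE _ _ _ _ _ (stage_map al s) a Ha (pull_triple pb) w); simpl.
- now rewrite <- comp_assoc, k1.
- exists q, P, m, d', pb; split; [exact sq|apply triple_equiv_refl].
- split; simpl; [now rewrite <- comp_assoc, k1|exact k2].
Qed.

(** The generic element of [U]: the identity of the apex is its witness. *)
Lemma mem_generic {C : pb_category} {A X : C} {U : gsub A X} {p : mono_span A X} :
  U p -> mem (lleg p) (stage_sub (rleg p) U).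
Proof.
intros Up; apply (mem_stage _ _ Up); exists (idm _); now rewrite !comp_id_r.
Qed.

(** A stable law is determined by its value at the generic element.  Stability
    only produces this with one particular proof of membership, whence the
    appeal to proof irrelevance. *)
Lemma stable_law_generic {C : pb_category} {A X E : C} {U : gsub A X}
    {sigma : law U E} (Hsigma : stable_law sigma) {p : mono_span A X} (Up : U p)
    {Y : C} {al : Hom Y X} {a : Hom Y A} (Ha : mem a (stage_sub al U))
    {a0 : Hom Y (apex p)} :
  lleg p ∘ a0 = a -> rleg p ∘ a0 = al ->
  sigma _ _ _ (mem_generic Up) ∘ a0 = sigma Y al a Ha.
Proof.
intros <- <-; rewrite Hsigma; f_equal; apply proof_irrelevance.
Qed.

Theorem proposition2p2 (C : pb_category) (A E X : C) (U : gsub A X)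
    (sigma : law U E) (Hsigma : stable_law sigma) :
  exists! s : gpmap U E,
    forall (Y : C) (al : Hom Y X) (a : Hom Y A) (Ha : mem a (stage_sub al U)),
      value (stage_map al s) Ha = sigma Y al a Ha.
Proof.
destruct (gsub_class U) as [p Hp].
assert (Up : U p) by apply Hp, span_equiv_refl.
destruct (gpmap_of_map Up (sigma _ _ _ (mem_generic Up))) as [s sq].
exists s; split.
- intros Y al a Ha.
  destruct (proj1 (mem_stage al a Up) Ha) as [a0 [h1 h2]].
  rewrite (value_stage s Ha sq h1 h2).
  exact (stable_law_generic Hsigma Up Ha h1 h2).
- intros s' Hs'; destruct (gpmap_rep_over s' p Up) as [t st].
  assert (e : t = sigma _ _ _ (mem_generic Up)).
  { rewrite <- (Hs' _ _ _ (mem_generic Up)).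
    rewrite (value_stage s' (mem_generic Up) st (comp_id_r (lleg p)) (comp_id_r (rleg p))); simpl.
    now rewrite comp_id_r. }
  rewrite e in st; exact (gpmap_eq sq st).
Qed.
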